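(* Let $K$ be any field and $T\in K^{m_1}\otimes K^{m_2}\otimes K^{m_3}$ a nonzero tensor. For every $\xi\in\Xi$, \[ G_\xi(T)\le\max_{p\in W(T)}\min_{i\in\{1,2,3\}}2^{H(p_i)/\xi_i}. \]
   Context: Support $\mathrm{supp}(T)$: triples $(j_1,j_2,j_3)$ with nonzero coefficient in the standard basis. $W(T)$: set of triples of marginals $(p_1,p_2,p_3)$ of probability distributions on $\mathrm{supp}(T)$. $H$: Shannon entropy base 2; $2^{H(p_i)/\xi_i}=+\infty$ if $\xi_i=0$. $\Xi=\{\xi\in\mathbb{R}^3_{\ge0}:\max\xi_i=1\}$. An $i$-slice: tensor whose $i$-th flattening has matrix rank one; slice decomposition of size $(r_1,r_2,r_3)$: sum of $r_i$ $i$-slices. $S_\xi(T)=\min\sum_ir_i^{1/\xi_i}$ ($\xi_i=0$ forces $r_i=0$, term omitted); $G_\xi(T)=\limsup_nS_\xi(T^{\otimes n})^{1/n}$ with Kronecker powers. *)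

(* Defs.v *)
From mathcomp Require Import all_boot all_order all_algebra.
From mathcomp Require Import all_classical all_reals all_analysis.
From mathcomp Require Import lra.
Set Implicit Arguments.
Unset Strict Implicit.
Unset Printing Implicit Defensive.
Import Order.TTheory GRing.Theory Num.Theory.
Local Open Scope classical_set_scope.
Local Open Scope ring_scope.

(* Tensors are given by their coordinates, over arbitrary finite index types:
   K^m1 (x) K^m2 (x) K^m3 is {ffun 'I_m1 * 'I_m2 * 'I_m3 -> K}. The index types
   of the n-th Kronecker power are the words {ffun 'I_n -> 'I_mi}, so that no
   bijection between these words and 'I_(mi ^ n) has to be chosen. *)
Section Tensors.
Variables (K : fieldType) (I1 I2 I3 : finType).
Implicit Type T : {ffun I1 * I2 * I3 -> K}.

Definition tensor_supp T : {set I1 * I2 * I3} := [set t | T t != 0]%SET.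

Definition kron_pow T (n : nat) :
    {ffun {ffun 'I_n -> I1} * {ffun 'I_n -> I2} * {ffun 'I_n -> I3} -> K} :=
  [ffun t : {ffun 'I_n -> I1} * {ffun 'I_n -> I2} * {ffun 'I_n -> I3} =>
    \prod_(k < n) T (t.1.1 k, t.1.2 k, t.2 k)].

Definition flattening1 T : 'M[K]_(#|I1|, #|{: I2 * I3}|) :=
  \matrix_(a, y) T (enum_val a, (enum_val y).1, (enum_val y).2).
Definition flattening2 T : 'M[K]_(#|I2|, #|{: I1 * I3}|) :=
  \matrix_(b, y) T ((enum_val y).1, enum_val b, (enum_val y).2).
Definition flattening3 T : 'M[K]_(#|I3|, #|{: I1 * I2}|) :=
  \matrix_(c, y) T ((enum_val y).1, (enum_val y).2, enum_val c).

Definition slice1 T : Prop := \rank (flattening1 T) = 1%N.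
Definition slice2 T : Prop := \rank (flattening2 T) = 1%N.
Definition slice3 T : Prop := \rank (flattening3 T) = 1%N.

Definition slice_decomposable T (r : nat * nat * nat) : Prop :=
  let: (r1, r2, r3) := r in
  exists (A : 'I_r1 -> {ffun I1 * I2 * I3 -> K})
         (B : 'I_r2 -> {ffun I1 * I2 * I3 -> K})
         (C : 'I_r3 -> {ffun I1 * I2 * I3 -> K}),
    [/\ forall j, slice1 (A j), forall j, slice2 (B j), forall j, slice3 (C j)
      & T = \sum_j A j + \sum_j B j + \sum_j C j].

End Tensors.

Section AsymptoticSliceRank.
Variable R : realType.
Implicit Type xi : R * R * R.

Definition Xi : set (R * R * R) :=
  [set xi | let: (x1, x2, x3) := xi in
    [/\ 0 <= x1, 0 <= x2, 0 <= x3 & Num.max x1 (Num.max x2 x3) = 1]].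

Definition slice_cost (x : R) (r : nat) : R :=
  if x == 0 then 0 else r%:R `^ x^-1.

Definition total_cost xi (r : nat * nat * nat) : R :=
  let: (x1, x2, x3) := xi in let: (r1, r2, r3) := r in
  slice_cost x1 r1 + slice_cost x2 r2 + slice_cost x3 r3.

Definition allowed_size xi (r : nat * nat * nat) : Prop :=
  let: (x1, x2, x3) := xi in let: (r1, r2, r3) := r in
  [/\ x1 = 0 -> r1 = 0%N, x2 = 0 -> r2 = 0%N & x3 = 0 -> r3 = 0%N].

Section Fixed.
Variables (K : fieldType) (I1 I2 I3 : finType).
Implicit Type T : {ffun I1 * I2 * I3 -> K}.

Definition admissible_sizes xi T : set (nat * nat * nat) :=
  [set r | allowed_size xi r /\ slice_decomposable T r].

(* The infimum is a minimum as soon as some size is admissible: see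
   [weighted_slice_rank_min]. *)
Definition weighted_slice_rank xi T : \bar R :=
  ereal_inf [set (total_cost xi r)%:E | r in admissible_sizes xi T].

Lemma slice_cost_ge0 (x : R) (r : nat) : 0 <= slice_cost x r.
Proof. by rewrite /slice_cost; case: eqP => // _; exact: powR_ge0. Qed.

Lemma le_slice_cost (x : R) (r : nat) :
  0 <= x <= 1 -> (x = 0 -> r = 0%N) -> r%:R <= slice_cost x r.
Proof.
rewrite /slice_cost => /andP[x0 x1]; case: eqP => [x_eq0 /(_ x_eq0) -> //|/eqP xn0 _].
have xgt0 : 0 < x by rewrite lt_def xn0.
case: r => [|r]; first exact: powR_ge0.
rewrite -[leLHS](powRr1 (ler0n _ _)) ler_powR ?ler1n//.
by rewrite invf_ge1.
Qed.

Lemma weighted_slice_rank_min xi T : Xi xi -> admissible_sizes xi T !=set0 ->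
  exists2 r, admissible_sizes xi T r &
    weighted_slice_rank xi T = (total_cost xi r)%:E.
Proof.
move: xi => [[x1 x2] x3] /= [x10 x20 x30 mx] [r0 Ar0].
have [x11 x21 x31] : [/\ x1 <= 1, x2 <= 1 & x3 <= 1].
  by move/eqP: mx; rewrite eq_le !ge_max => /andP[/and3P[]].
set xi := (x1, x2, x3) in Ar0 *.
have bnd r : admissible_sizes xi T r ->
    [/\ r.1.1%:R <= total_cost xi r, r.1.2%:R <= total_cost xi r
      & r.2%:R <= total_cost xi r].
  case: r => [[r1 r2] r3] [[z1 z2 z3] _] /=.
  have l1 := @le_slice_cost x1 r1 _ z1; have l2 := @le_slice_cost x2 r2 _ z2.
  have l3 := @le_slice_cost x3 r3 _ z3; rewrite x10 x11 in l1.
  rewrite x20 x21 in l2; rewrite x30 x31 in l3.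
  move: (l1 isT) (l2 isT) (l3 isT) (slice_cost_ge0 x1 r1)
    (slice_cost_ge0 x2 r2) (slice_cost_ge0 x3 r3) => *; split; lra.
pose N := (Num.truncn (total_cost xi r0)).+1.
have ltN r k : total_cost xi r <= total_cost xi r0 ->
    k%:R <= total_cost xi r -> (k < N)%N.
  move=> h1 h2; rewrite -(ltr_nat R); apply: (le_lt_trans h2).
  by apply: (le_lt_trans h1); exact: truncnS_gt.
pose small r := admissible_sizes xi T r /\ total_cost xi r <= total_cost xi r0.
pose v (i : 'I_N * 'I_N * 'I_N) := (i.1.1 : nat, i.1.2 : nat, i.2 : nat).
have lift r : small r -> exists i, v i = r.
  case: r => [[r1 r2] r3] [Ar le0]; have [b1 b2 b3] := bnd _ Ar.
  exists (Ordinal (ltN _ _ le0 b1), Ordinal (ltN _ _ le0 b2),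
          Ordinal (ltN _ _ le0 b3)) => //.
have [i0 vi0] : exists i, v i = r0 by apply: lift.
have Pi0 : `[< admissible_sizes xi T (v i0) >] by rewrite vi0; apply/asboolP.
case: (@arg_minP _ _ _ i0 (fun i => `[< admissible_sizes xi T (v i) >])
  (fun i => total_cost xi (v i)) Pi0) => i /asboolP Ai mini.
exists (v i) => //; apply/eqP; rewrite eq_le; apply/andP; split.
  by apply: ereal_inf_lbound; exists (v i).
apply: le_ereal_inf_tmp => _ [r Ar <-]; rewrite lee_fin.
have [le0|/ltW ge0] := leP (total_cost xi r) (total_cost xi r0).
  have [j vj] : exists i, v i = r by apply: lift.
  by rewrite -vj; apply: mini; rewrite vj; apply/asboolP.
by apply: le_trans ge0; rewrite -vi0; apply: mini.
Qed.

End Fixed.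

(* The term n = 0, in which n%:R^-1 = 0, does not affect the limsup. *)
Definition asymptotic_slice_rank (K : fieldType) (I1 I2 I3 : finType) xi
    (T : {ffun I1 * I2 * I3 -> K}) : \bar R :=
  limn_esup (fun n => (weighted_slice_rank xi (kron_pow T n) `^ n%:R^-1)%E).

(* [ln 0 = 0], hence the convention 0 log 0 = 0 *)
Definition entropy2 (I : finType) (p : I -> R) : R :=
  - \sum_(a : I) p a * (ln (p a) / ln 2).

Definition exp2_ratio (h x : R) : \bar R :=
  if x == 0 then +oo%E else (2 `^ (h / x))%:E.

Section Marginals.
Variables (K : fieldType) (I1 I2 I3 : finType).

Definition distribution_on (I : finType) (A : {set I}) (P : I -> R) : Prop :=
  [/\ forall t, 0 <= P t, forall t, t \notin A -> P t = 0 & \sum_t P t = 1].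

Definition marginals (P : I1 * I2 * I3 -> R) :
    (I1 -> R) * (I2 -> R) * (I3 -> R) :=
  (fun a => \sum_b \sum_c P (a, b, c),
   fun b => \sum_a \sum_c P (a, b, c),
   fun c => \sum_a \sum_b P (a, b, c)).

Definition W (T : {ffun I1 * I2 * I3 -> K}) :
    set ((I1 -> R) * (I2 -> R) * (I3 -> R)) :=
  [set marginals P | P in distribution_on (tensor_supp T)].

Definition min_exp2_entropy xi (p : (I1 -> R) * (I2 -> R) * (I3 -> R)) :
    \bar R :=
  let: (x1, x2, x3) := xi in let: (p1, p2, p3) := p in
  Order.min (exp2_ratio (entropy2 p1) x1)
    (Order.min (exp2_ratio (entropy2 p2) x2) (exp2_ratio (entropy2 p3) x3)).

End Marginals.
End AsymptoticSliceRank.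

Definition is_maximum (R : realType) (A : set (\bar R)) (M : \bar R) : Prop :=
  A M /\ ubound A M.

(* Main.v *)
(** The method of types. Let [2 ^ h] be the maximum on the right-hand side. The
    empirical distribution of a triple of words in the support of the [n]-th
    Kronecker power is supported on [supp T], so its marginals, which are the
    types of the three words, lie in [W T]; hence for some [i] the type of the
    [i]-th word has entropy at most [xi_i * h]. Covering the support by the
    [i]-slices through such low-entropy words uses at most
    [(n + 1) ^ m_i * 2 ^ (n * xi_i * h)] slices in direction [i], so the cost
    is [2 ^ (n * h)] up to a polynomial factor, which the [n]-th root kills. The
    maximum exists because entropy is continuous on the compact simplex. *)
Require Import Defs.
From mathcomp Require Import all_boot all_order all_algebra.
From mathcomp Require Import all_classical all_reals all_analysis.
From mathcomp Require Import ring lra.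
Set Implicit Arguments.
Unset Strict Implicit.
Unset Printing Implicit Defensive.
Import Order.TTheory GRing.Theory Num.Theory.
Import numFieldNormedType.Exports.
Local Open Scope classical_set_scope.
Local Open Scope ring_scope.

(** * Slice decompositions from covers of the support *)

Lemma mxrank_single_row (K : fieldType) (m n : nat) (A : 'M[K]_(m, n)) i0 :
  A != 0 -> (forall i j, i != i0 -> A i j = 0) -> \rank A = 1%N.
Proof.
move=> A0 Ai; apply/eqP; rewrite eqn_leq lt0n mxrank_eq0 A0 andbT.
have -> : A = delta_mx i0 (0 : 'I_1) *m row i0 A.
  apply/matrixP => i j; rewrite !mxE big_ord1 !mxE eqxx andbT.
  by have [->|/Ai->] := eqVneq i i0; rewrite ?mul1r ?mul0r.
by rewrite (leq_trans (mxrankM_maxr _ _))// rank_leq_row.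
Qed.

Section Slices.
Variables (K : fieldType) (I1 I2 I3 : finType).
Implicit Type T : {ffun I1 * I2 * I3 -> K}.

(** All but one row of the flattening vanish, and being nonzero excludes rank 0. *)
Lemma single_fiber_slice1 T a :
  T != 0 -> (forall t, t.1.1 != a -> T t = 0) -> slice1 T.
Proof.
move=> T0 Ta; apply: (@mxrank_single_row _ _ _ _ (enum_rank a)); last first.
  move=> i j; rewrite mxE => ia; apply: Ta => /=.
  by apply: contra_neq ia => <-; rewrite enum_valK.
apply: contra_neq T0 => F0; apply/ffunP => -[[x y] z]; rewrite ffunE.
have /matrixP/(_ (enum_rank x) (enum_rank (y, z))) := F0.
by rewrite !mxE !enum_rankK.
Qed.

Lemma single_fiber_slice2 T b :
  T != 0 -> (forall t, t.1.2 != b -> T t = 0) -> slice2 T.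
Proof.
move=> T0 Tb; apply: (@mxrank_single_row _ _ _ _ (enum_rank b)); last first.
  move=> i j; rewrite mxE => ib; apply: Tb => /=.
  by apply: contra_neq ib => <-; rewrite enum_valK.
apply: contra_neq T0 => F0; apply/ffunP => -[[x y] z]; rewrite ffunE.
have /matrixP/(_ (enum_rank y) (enum_rank (x, z))) := F0.
by rewrite !mxE !enum_rankK.
Qed.

Lemma single_fiber_slice3 T c :
  T != 0 -> (forall t, t.2 != c -> T t = 0) -> slice3 T.
Proof.
move=> T0 Tc; apply: (@mxrank_single_row _ _ _ _ (enum_rank c)); last first.
  move=> i j; rewrite mxE => ic; apply: Tc => /=.
  by apply: contra_neq ic => <-; rewrite enum_valK.
apply: contra_neq T0 => F0; apply/ffunP => -[[x y] z]; rewrite ffunE.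
have /matrixP/(_ (enum_rank z) (enum_rank (x, y))) := F0.
by rewrite !mxE !enum_rankK.
Qed.

End Slices.

(** [T] is cut along the fibers of [pi]. Zero pieces are discarded, since a slice has rank exactly
    one; hence the count is only bounded by the size of [A]. Keeping [pi] and [slice] abstract
    serves all three directions. *)
Lemma sum_of_fibers (V : zmodType) (J I : finType) (pi : J -> I)
    (slice : {ffun J -> V} -> Prop) (T : {ffun J -> V}) (A : {set I}) :
    (forall a (S : {ffun J -> V}),
      S != 0 -> (forall t, pi t != a -> S t = 0) -> slice S) ->
    (forall t, pi t \notin A -> T t = 0) ->
  exists (r : nat) (S : 'I_r -> {ffun J -> V}),
    [/\ (r <= #|A|)%N, forall j, slice (S j) & T = \sum_j S j].
Proof.
move=> sliceP TA.
pose fiber a : {ffun J -> V} := [ffun t => if pi t == a then T t else 0].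
pose B := [set a in A | fiber a != 0]%SET.
exists #|B|, (fun j => fiber (enum_val j)); split.
- by apply/subset_leq_card/fintype.subsetP => a; rewrite inE => /andP[].
- move=> j; have := enum_valP j; rewrite inE => /andP[_ fj].
  by apply: (sliceP (enum_val j)) => // t tj; rewrite ffunE (negPf tj).
- rewrite -(@big_enum_val _ _ _ _ (mem B) fiber)/=.
  apply/ffunP => t; rewrite sum_ffunE.
  have [Tt0|Tt0] := eqVneq (T t) 0.
    by rewrite big1// => a _; rewrite ffunE Tt0 if_same.
  have Bt : pi t \in B.
    rewrite inE; apply/andP; split; first by apply: contraNT Tt0 => /TA/eqP.
    by apply: contra_neq Tt0 => /ffunP/(_ t); rewrite !ffunE eqxx.
  rewrite (bigD1 (pi t))//= ffunE eqxx big1 ?addr0// => a /andP[_ at'].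
  by rewrite ffunE eq_sym (negPf at').
Qed.

Lemma slice_decomposition_of_cover (K : fieldType) (I1 I2 I3 : finType)
    (T : {ffun I1 * I2 * I3 -> K})
    (A1 : {set I1}) (A2 : {set I2}) (A3 : {set I3}) :
    (forall t, T t != 0 -> [|| t.1.1 \in A1, t.1.2 \in A2 | t.2 \in A3]) ->
  exists r1 r2 r3, [/\ (r1 <= #|A1|)%N, (r2 <= #|A2|)%N, (r3 <= #|A3|)%N &
    slice_decomposable T (r1, r2, r3)].
Proof.
move=> cover.
(* Each entry goes to the first direction that covers it. [T3] takes all that is left, which the
   cover forces into [A3]. *)
pose T1 : {ffun I1 * I2 * I3 -> K} :=
  [ffun t => if t.1.1 \in A1 then T t else 0].
pose T2 : {ffun I1 * I2 * I3 -> K} :=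
  [ffun t => if (t.1.1 \notin A1) && (t.1.2 \in A2) then T t else 0].
pose T3 : {ffun I1 * I2 * I3 -> K} :=
  [ffun t => if (t.1.1 \notin A1) && (t.1.2 \notin A2) then T t else 0].
have TE : T = T1 + T2 + T3.
  apply/ffunP => t; rewrite !ffunE.
  by case: (_ \in A1); case: (_ \in A2); rewrite /= ?addr0 ?add0r.
have [||r1 [S1 [le1 sl1 E1]]] :=
    @sum_of_fibers _ _ _ (fun t => t.1.1) (@slice1 _ _ _ _) T1 A1.
- by move=> a S; exact: single_fiber_slice1.
- by move=> t /negPf tA; rewrite ffunE tA.
have [||r2 [S2 [le2 sl2 E2]]] :=
    @sum_of_fibers _ _ _ (fun t => t.1.2) (@slice2 _ _ _ _) T2 A2.
- by move=> a S; exact: single_fiber_slice2.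
- by move=> t /negPf tA; rewrite ffunE tA andbF.
have [||r3 [S3 [le3 sl3 E3]]] :=
    @sum_of_fibers _ _ _ (fun t => t.2) (@slice3 _ _ _ _) T3 A3.
- by move=> a S; exact: single_fiber_slice3.
- move=> t /negPf tA; rewrite ffunE.
  case: ifPn => // /andP[/negPf t1 /negPf t2].
  by apply/eqP/contraT => /cover; rewrite t1 t2 tA.
exists r1, r2, r3; split=> //; exists S1, S2, S3; split=> //.
by rewrite -E1 -E2 -E3.
Qed.

(** * Types of words and the number of words of low entropy *)

Section EmpiricalDistribution.
Variables (R : realType) (n : nat).

Definition empirical (I : finType) (w : {ffun 'I_n -> I}) (x : I) : R :=
  (\sum_(k < n) (w k == x))%:R / n%:R.

Lemma empirical_ge0 (I : finType) (w : {ffun 'I_n -> I}) x :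
  0 <= empirical w x.
Proof. by rewrite divr_ge0. Qed.

Lemma sum_empirical (I : finType) (w : {ffun 'I_n -> I}) (F : I -> R) :
  \sum_x empirical w x * F x = (\sum_(k < n) F (w k)) / n%:R.
Proof.
under eq_bigr do rewrite /empirical natr_sum mulrAC mulr_suml.
rewrite -mulr_suml exchange_big/=; congr (_ / _); apply: eq_bigr => k _.
rewrite (bigD1 (w k))//= eqxx mul1r big1 ?addr0// => x.
by rewrite eq_sym => /negPf->; rewrite mul0r.
Qed.

Lemma sum_empirical1 (I : finType) (w : {ffun 'I_n -> I}) :
  (0 < n)%N -> \sum_x empirical w x = 1.
Proof.
move=> n0; have := sum_empirical w (fun=> 1).
under eq_bigr do rewrite mulr1.
by move=> ->; rewrite sumr_const card_ord divff// pnatr_eq0 -lt0n.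
Qed.

Lemma empirical_gt0 (I : finType) (w : {ffun 'I_n -> I}) k :
  0 < empirical w (w k).
Proof.
have n0 : (0 < n)%N by apply: leq_trans (ltn_ord k).
by rewrite divr_gt0 ?ltr0n// (bigD1 k)//= eqxx.
Qed.

(** The logarithm of the product is [n] times the average of ln p(w_k) along the word, and
    [sum_empirical] turns this average into the sum of p ln p. *)
Lemma prod_empirical (I : finType) (w : {ffun 'I_n -> I}) : (0 < n)%N ->
  \prod_(k < n) empirical w (w k) = 2 `^ (- (n%:R * entropy2 (empirical w))).
Proof.
move=> n0; have ln2 : ln 2 != 0 :> R by rewrite gt_eqF// ln_gt0// ltr1n.
rewrite /entropy2 mulrN opprK.
under [\sum_a _]eq_bigr do rewrite mulrA.
rewrite -mulr_suml sum_empirical /powR pnatr_eq0/=.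
rewrite mulrA mulrCA mulfV ?mulr1 ?pnatr_eq0 -?lt0n//.
rewrite divfK// expR_sum; apply: eq_bigr => k _.
by rewrite lnK// posrE empirical_gt0.
Qed.

(* The words of a given type have total probability at most 1 under the n-th
   power of that type, and there are at most (n + 1) ^ #|I| types. *)
Lemma sum_prod_empirical_le (I : finType) : (0 < n)%N ->
  \sum_(w : {ffun 'I_n -> I}) \prod_(k < n) empirical w (w k)
    <= (n.+1 ^ #|I|)%:R.
Proof.
move=> n0; pose cnt (w : {ffun 'I_n -> I}) : {ffun I -> 'I_n.+1} :=
  [ffun x => inord (\sum_(k < n) (w k == x))].
have cntE w x : empirical w x = (cnt w x)%:R / n%:R.
  rewrite ffunE inordK// ltnS -[leqRHS]card_ord -sum1_card.
  by apply: leq_sum => k _; exact: leq_b1.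
rewrite (partition_big cnt predT)//=.
have -> : (n.+1 ^ #|I|)%:R = \sum_(c : {ffun I -> 'I_n.+1}) 1 :> R.
  by rewrite sumr_const card_ffun card_ord.
apply: ler_sum => c _; have [[w0 w0c]|noc] := pselect (exists w, cnt w = c).
  (* Here 1 is the total mass of the n-th product power of the type of [w0], expanded over all
     words; the words with counts [c] contribute only some of its nonnegative terms. *)
  rewrite [leRHS](_ : 1 =
    \sum_(w : {ffun 'I_n -> I}) \prod_(k < n) empirical w0 (w k)); last first.
    rewrite -(bigA_distr_bigA (fun=> empirical w0)) big1// => k _.
    exact: sum_empirical1.
  rewrite big_mkcond/=; apply: ler_sum => w _; case: eqP => [wc|_].
    by apply: ler_prod => k _; rewrite empirical_ge0 !cntE wc w0c /=.
  by apply: prodr_ge0 => k _; exact: empirical_ge0.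
by rewrite big1// => w /eqP wc; case: noc; exists w.
Qed.

(** By [prod_empirical] each such word contributes at least 2 ^ (- n h) to the sum bounded in
    [sum_prod_empirical_le]. *)
Lemma card_low_entropy_le (I : finType) (h : R) : (0 < n)%N ->
  #|[set w : {ffun 'I_n -> I} | entropy2 (empirical w) <= h]%SET|%:R
    <= (n.+1 ^ #|I|)%:R * 2 `^ (n%:R * h) :> R.
Proof.
move=> n0; rewrite -ler_pdivrMr ?powR_gt0//.
apply: le_trans (sum_prod_empirical_le I n0).
rewrite mulrC mulr_natr -sumr_const big_mkcond/=.
apply: ler_sum => w _; rewrite inE; case: ifPn => [wh|_]; last first.
  by apply: prodr_ge0 => k _; exact: empirical_ge0.
rewrite prod_empirical// -powRN ler_powR ?ler1n// lerN2.
by rewrite ler_wpM2l.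
Qed.

End EmpiricalDistribution.

(** * Continuity of entropy and compactness of the simplex *)

Lemma normr_xlnx_le (R : realType) (x : R) :
  x < 1 -> `|x * ln x| <= 2 * Num.sqrt x.
Proof.
move=> x1; have [x0|x0] := leP x 0.
  by rewrite ln0// mulr0 normr0 mulr_ge0// sqrtr_ge0.
have s0 : 0 < Num.sqrt x by rewrite sqrtr_gt0.
rewrite ler0_norm; last by rewrite mulr_ge0_le0 ?ln_le0// ltW.
set s := Num.sqrt x in s0 *.
have xE : x = s ^+ 2 by rewrite sqr_sqrtr// ltW.
(* Since |x ln x| = 2 s^2 ln(1/s), this estimate leaves 2 s. *)
have /ltW ls : ln s^-1 < s^-1 by apply: ln_sublinear; rewrite invr_gt0.
rewrite lnV ?posrE// in ls.
rewrite xE lnXn// -mulrN -mulNrn.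
have -> : 2 * s = s ^+ 2 * (s^-1 *+ 2) by field; rewrite gt_eqF.
by rewrite ler_wpM2l ?sqr_ge0// lerMn2r.
Qed.

Lemma continuous_xlnx (R : realType) : continuous (fun x : R => x * ln x).
Proof.
move=> x; have [x0|x0|<-] := ltgtP 0 x.
- by apply: cvgM; [exact: cvg_id|exact: continuous_ln].
- rewrite /continuous_at ln0 ?ltW// mulr0.
  apply: cvg_near_cst; near=> y; rewrite ln0 ?mulr0//; apply/ltW.
  by near: y; exact: lt_nbhsl.
(* The squeeze at 0 is two-sided: the bound covers negative [y] too, where [ln] takes the default
   value 0. *)
- rewrite /continuous_at mul0r; apply/norm_cvg0P.
  apply: (@squeeze_cvgr _ _ _ _ (fun=> 0) (fun y => 2 * Num.sqrt y)).
  + near=> y; rewrite normr_ge0/= normr_xlnx_le//.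
    by near: y; exact: lt_nbhsl.
  + exact: cvg_cst.
  + rewrite -[X in _ --> X](mulr0 2) -[X in 2 * X](sqrtr0 R).
    by apply: cvgM; [exact: cvg_cst|exact: sqrt_continuous].
Unshelve. all: by end_near. Qed.

Lemma continuous_fsum (R : realType) (X : topologicalType) (J : finType)
    (F : J -> X -> R) :
  (forall j, continuous (F j)) -> continuous (fun x => \sum_j F j x).
Proof.
move=> Fc; apply: continuous_big => // z.
exact: (@add_continuous R^o).
Qed.

Lemma continuous_entropy2 (R : realType) (X : topologicalType) (I : finType)
    (p : X -> I -> R) :
  (forall a, continuous (fun x => p x a)) ->
  continuous (fun x => entropy2 (p x)).
Proof.
move=> pc x; apply: cvgN; apply: continuous_fsum => {x} a x.
under eq_fun do rewrite mulrA; apply: cvgM; last exact: cvg_cst.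
apply: (@continuous_comp _ _ _ (p^~ a) (fun y => y * ln y)); first exact: pc.
exact: continuous_xlnx.
Qed.

(** The support condition is absorbed into the factors of a Tychonoff product: [0, 1] on [A], the
    point 0 elsewhere. Total mass 1 is then a closed condition, as evaluations are continuous for
    the pointwise topology [ptws]. *)
Lemma compact_distribution_on (R : realType) (J : finType) (A : {set J}) :
  compact (distribution_on A : set {ptws J -> R}).
Proof.
pose B (t : J) : set R := if t \in A then `[0, 1]%classic else [set 0].
have cB t : compact (B t).
  rewrite /B; case: ifP => _; [exact: segment_compact|exact: compact_set1].
have -> : (distribution_on A : set {ptws J -> R}) =
    [set f | forall t, B t (f t)] `&` [set f | \sum_t f t = 1].
  apply/seteqP; split=> [f [f0 fA f1]|f [fB f1]].
    split=> // t; rewrite /B; case: ifPn => [_|/fA//].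
    by rewrite /= in_itv/= f0/= -f1 (bigD1 t)//= lerDl sumr_ge0.
  split=> // t; have := fB t; rewrite /B; case: ifPn => //=.
  - by rewrite in_itv => _ /andP[].
  - by move=> _ ->.
apply: compact_closedI; first exact: tychonoff.
apply: (@preimage_closed _ _ (fun f : {ptws J -> R} => \sum_t f t) [set 1]);
  last exact: closed_eq.
move=> f _; apply: continuous_fsum => t.
exact: (@proj_continuous J (fun=> R) t).
Qed.

(** * Existence of the maximum *)

Section Maximum.
Variables (R : realType) (K : fieldType) (I1 I2 I3 : finType).

Lemma distribution_on_supp_nonempty (T : {ffun I1 * I2 * I3 -> K}) : T <> 0 ->
  (distribution_on (tensor_supp T) : set (_ -> R)) !=set0.
Proof.
move=> /eqP T0; have [t Tt] : exists t, T t != 0.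
  apply/existsP; apply: contraNT T0; rewrite negb_exists => /forallP T0.
  apply/eqP/ffunP => t; rewrite ffunE; apply/eqP.
  by have := T0 t; rewrite negbK.
exists (fun s => (s == t)%:R); split=> [s|s|].
- exact: ler0n.
- apply: contraNeq; rewrite pnatr_eq0 eqb0 negbK => /eqP->.
  by rewrite inE.
- by rewrite (bigD1 t)//= eqxx big1 ?addr0// => s /negPf->.
Qed.

Lemma max_min_exp2_entropy (T : {ffun I1 * I2 * I3 -> K}) (xi : R * R * R) :
  T <> 0 -> Xi xi ->
  exists h : R,
    is_maximum [set min_exp2_entropy xi p | p in W T] (2 `^ h)%:E.
Proof.
case: xi => [[x1 x2] x3] T0 [x10 x20 x30 xmax].
pose X := {ptws (I1 * I2 * I3) -> R}.
(* This class is stable under minima and reduces the extended-real maximum to that of a continuous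
   real exponent [g]. *)
pose ok (F : X -> \bar R) :=
  (forall P, F P = +oo%E) \/
  exists2 g : X -> R, continuous g & forall P, F P = (2 `^ g P)%:E.
have okmin F G : ok F -> ok G -> ok (fun P => Order.min (F P) (G P)).
  move=> [Foo|[f fc fE]] [Goo|[g gc gE]].
  - by left=> P; rewrite Foo Goo minxx.
  - by right; exists g => // P; rewrite Foo min_r ?leey.
  - by right; exists f => // P; rewrite Goo min_l ?leey.
  - right; exists (f \min g) => [P|P].
      exact: (@continuous_min R X f g P (fc P) (gc P)).
    rewrite fE gE -EFin_min /= /Order.min; congr EFin.
    have lt2 : (2 `^ f P < 2 `^ g P) = (f P < g P).
      rewrite /powR pnatr_eq0/= ltr_expR ltr_pM2r// ln_gt0// ltr1n//.
    by rewrite lt2; case: ifP.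
have okE (I : finType) (p : X -> I -> R) x :
    (forall a, continuous (fun P => p P a)) ->
    ok (fun P => exp2_ratio (entropy2 (p P)) x).
  move=> pc; rewrite /exp2_ratio; case: eqP => [_|_]; first by left.
  right; exists (fun P => entropy2 (p P) / x) => // P.
  apply: (@continuousM R X (fun P => entropy2 (p P)) (cst x^-1) P).
    exact: (continuous_entropy2 pc).
  exact: cst_continuous.
have projc t : continuous (fun P : X => P t).
  exact: (@proj_continuous _ (fun=> R) t).
pose F (P : X) := min_exp2_entropy (x1, x2, x3) (marginals P).
have [Foo|[g gc gE]] : ok F.
  apply: (okmin _ _ _ (okmin _ _ _ _)); apply: okE => a;
    by do 2 (apply: continuous_fsum => ?).
(* The minimum is infinite only if all three weights vanish, which max xi_i = 1 excludes. *)
- have [P _] := distribution_on_supp_nonempty T0; have := Foo P.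
  rewrite /F /min_exp2_entropy /exp2_ratio/=.
  have [x1E|_] := eqVneq x1 0; have [x2E|_] := eqVneq x2 0;
    have [x3E|_] := eqVneq x3 0; rewrite ?minye ?miney -?EFin_min//.
  by move: xmax; rewrite x1E x2E x3E !maxxx => /eqP; rewrite eq_sym oner_eq0.
have [Q] := @compact_EVT_max X R g _ (distribution_on_supp_nonempty T0)
  (@compact_distribution_on R _ (tensor_supp T)) (continuous_subspaceT gc).
rewrite inE => QT maxQ; exists (g Q); split.
  by exists (marginals Q); [exists Q|rewrite -gE].
move=> _ [_ [P PT <-] <-]; rewrite -[leLHS]/(F P) gE lee_fin ler_powR ?ler1n//.
by apply: maxQ; rewrite inE.
Qed.

End Maximum.

(** * Upper limits and roots of polynomial factors *)

Lemma limn_esup_le (R : realType) (u : nat -> \bar R) (l : \bar R) :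
  (forall e : R, 0 < e -> \forall n \near \oo, (u n <= l + e%:E)%E) ->
  (limn_esup u <= l)%E.
Proof.
move=> ul; apply/lee_addgt0Pr => e e0; apply: ge_ereal_inf.
(* The upper limit is an infimum of suprema over the sets of the filter; the set where the bound
   holds is one of them. *)
exists (ereal_sup (u @` [set n | (u n <= l + e%:E)%E])).
  by exists [set n | (u n <= l + e%:E)%E] => //; exact: ul.
by apply: ge_ereal_sup => _ [n un <-].
Qed.

Lemma cvg_root_polynomial (R : realType) (c d : R) : 0 < c ->
  (c * n.+1%:R `^ d) `^ n%:R^-1 @[n --> \oo] --> (1 : R).
Proof.
move=> c0.
have invn : n%:R^-1 @[n --> \oo] --> (0 : R).
  by rewrite -cvg_shiftS; exact: cvg_harmonic.
(* [harmonic n] is 1/(n+1), so this is continuity of x ln x at 0. *)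
have lnn : harmonic n * ln (harmonic n) @[n --> \oo] --> (0 : R).
  have := cvg_comp harmonic (fun y : R => y * ln y) (@cvg_harmonic R)
    (@continuous_xlnx R 0).
  by rewrite mul0r.
suff : (c * n.+1%:R `^ d) `^ n%:R^-1 @[n --> \oo] --> expR (0 : R).
  by rewrite expR0.
have -> : (fun n => (c * n.+1%:R `^ d) `^ n%:R^-1) =
    (fun n => expR (n%:R^-1 * (ln c + d * ln n.+1%:R))).
  apply/funext => n; rewrite /powR mulf_eq0 (gt_eqF c0)/= pnatr_eq0/=.
  by rewrite gt_eqF ?expR_gt0// lnM ?posrE ?expR_gt0// expRK.
apply: (@continuous_cvg _ _ _ _ _ _ expR); first exact: continuous_expR.
(* For n > 0, ln(n+1)/n = - (1 + 1/n) y ln y with y = 1/(n+1). *)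
have lim0 : n%:R^-1 * ln c
    - d * ((1 + n%:R^-1) * (harmonic n * ln (harmonic n))) @[n --> \oo]
    --> (0 : R).
  rewrite -[X in _ --> X](_ : 0 * ln c - d * ((1 + 0) * 0) = 0); last by ring.
  apply: cvgB; first by apply: cvgM invn (cvg_cst _).
  by apply: cvgM (cvg_cst _) (cvgM (cvgD (cvg_cst _) invn) lnn).
apply: cvg_trans lim0; apply: near_eq_cvg; near=> n.
have n0 : n%:R != 0 :> R by rewrite pnatr_eq0 -lt0n; near: n; exists 1%N.
rewrite /= lnV ?posrE// -natr1; field.
by rewrite n0 natr1 pnatr_eq0.
Unshelve. all: by end_near. Qed.

(** * Weighted slice rank of a Kronecker power *)

Section KroneckerPower.
Variables (R : realType) (K : fieldType) (I1 I2 I3 : finType) (n : nat).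
Implicit Type T : {ffun I1 * I2 * I3 -> K}.

(* Empty at x = 0, where no slice is allowed; the test is also needed because
   [0 * h] would still admit the words of entropy 0. *)
Definition low_entropy_words (I : finType) (x h : R) : {set {ffun 'I_n -> I}} :=
  if x == 0 then finset.set0
  else [set w | entropy2 (empirical R w) <= x * h]%SET.

(** The exponent 1/x of the cost cancels the factor [x] in the entropy threshold, so every direction
    gets the same exponential rate [h]. *)
Lemma slice_cost_low_entropy_le (I : finType) (x h : R) r : (0 < n)%N ->
  0 <= x -> (r <= #|low_entropy_words I x h|)%N ->
  slice_cost x r <= n.+1%:R `^ (#|I|%:R / x) * 2 `^ (n%:R * h).
Proof.
move=> n0 x0; rewrite /slice_cost /low_entropy_words.
have [_ _|xn0] := eqVneq x 0; first by rewrite mulr_ge0 ?powR_ge0.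
rewrite -(ler_nat R) => /le_trans/(_ (card_low_entropy_le _ _ n0)) rle.
have := ge0_ler_powR (_ : 0 <= x^-1) _ _ rle.
rewrite !nnegrE invr_ge0 x0 ler0n mulr_ge0 ?powR_ge0// => /(_ isT isT isT).
move=> /le_trans; apply; rewrite powRM ?powR_ge0// natrX -powR_mulrn//.
rewrite -!powRrM (_ : n%:R * (x * h) * x^-1 = n%:R * h)//.
by field.
Qed.

Lemma kron_pow_supp T t : kron_pow T n t != 0 ->
  forall k, T (t.1.1 k, t.1.2 k, t.2 k) != 0.
Proof.
rewrite ffunE prodf_seq_neq0 => /allP Tt k.
by have := Tt k; rewrite mem_index_enum => /(_ isT).
Qed.

Lemma empirical_in_W T t : (0 < n)%N -> kron_pow T n t != 0 ->
  W T (empirical R t.1.1, empirical R t.1.2, empirical R t.2).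
Proof.
move=> n0 /kron_pow_supp Tt.
pose w : {ffun 'I_n -> I1 * I2 * I3} := [ffun k => (t.1.1 k, t.1.2 k, t.2 k)].
have wE k : w k = (t.1.1 k, t.1.2 k, t.2 k) by rewrite ffunE.
(* Taking for [F] the indicator of one coordinate value identifies each marginal of the joint type
   with the type of a single word. *)
have sumw (F : I1 * I2 * I3 -> R) :
    \sum_a \sum_b \sum_c empirical R w (a, b, c) * F (a, b, c) =
    (\sum_(k < n) F (t.1.1 k, t.1.2 k, t.2 k)) / n%:R.
  rewrite pair_big/= pair_big/=.
  under [in RHS]eq_bigr => k _ do rewrite -wE.
  by rewrite -sum_empirical; apply: eq_bigr => -[[]].
have fiber (I : finType) (v : {ffun 'I_n -> I}) a :
    empirical R v a = (\sum_(k < n) (v k == a)%:R) / n%:R.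
  by rewrite /empirical natr_sum.
exists (empirical R w); last first.
  rewrite /marginals; congr (_, _, _); apply/funext => x; rewrite fiber.
  - rewrite -(sumw (fun s => (s.1.1 == x)%:R)) (bigD1 x)//=.
    rewrite [X in _ + X]big1 ?addr0.
      by apply: eq_bigr => b _; apply: eq_bigr => c _; rewrite eqxx mulr1.
    move=> a /negPf ax; apply: big1 => b _; apply: big1 => c _.
    by rewrite ax mulr0.
  - rewrite -(sumw (fun s => (s.1.2 == x)%:R)); apply: eq_bigr => a _.
    rewrite (bigD1 x)//= [X in _ + X]big1 ?addr0.
      by apply: eq_bigr => c _; rewrite eqxx mulr1.
    by move=> b /negPf bx; apply: big1 => c _; rewrite bx mulr0.
  - rewrite -(sumw (fun s => (s.2 == x)%:R)); apply: eq_bigr => a _.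
    apply: eq_bigr => b _; rewrite (bigD1 x)//= eqxx mulr1 big1 ?addr0//.
    by move=> c /negPf cx; rewrite cx mulr0.
split=> [s|s|]; [exact: empirical_ge0| |exact: sum_empirical1].
(* A triple outside the support never occurs as a letter of [w], so its frequency is 0. *)
rewrite inE negbK => /eqP Ts0; rewrite /empirical big1 ?mul0r// => k _.
by rewrite ffunE; case: eqP => // ks; have := Tt k; rewrite ks Ts0 eqxx.
Qed.

(** The factor 3 counts the directions, and [d] is a common polynomial exponent. For a zero weight
    the quotient is 0 by convention, so its hypothesis says 0 <= [d]. *)
Lemma weighted_slice_rank_kron_pow_le T (xi : R * R * R) (h d : R) :
    (0 < n)%N -> Xi xi ->
    (forall p, W T p -> (min_exp2_entropy xi p <= (2 `^ h)%:E)%E) ->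
    #|I1|%:R / xi.1.1 <= d -> #|I2|%:R / xi.1.2 <= d -> #|I3|%:R / xi.2 <= d ->
  (weighted_slice_rank xi (kron_pow T n)
    <= (3 * n.+1%:R `^ d * 2 `^ (n%:R * h))%:E)%E.
Proof.
case: xi => [[x1 x2] x3] n0 [x10 x20 x30 _] Wh /= d1 d2 d3.
(* At [x = 0] the premise would bound +oo by a real, so a direction that meets it has positive
   weight. *)
have low (I : finType) x (w : {ffun 'I_n -> I}) : 0 <= x ->
    (exp2_ratio (entropy2 (empirical R w)) x <= (2 `^ h)%:E)%E ->
    w \in low_entropy_words I x h.
  move=> x0; rewrite /exp2_ratio /low_entropy_words; case: eqVneq => // xn0.
  rewrite inE lee_fin /powR pnatr_eq0/= ler_expR ler_pM2r ?ln_gt0 ?ltr1n//.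
  by rewrite ler_pdivrMr 1?mulrC// lt_def xn0.
have [t|r1 [r2 [r3 [le1 le2 le3 dec]]]] := @slice_decomposition_of_cover _ _ _ _
  (kron_pow T n) (low_entropy_words I1 x1 h) (low_entropy_words I2 x2 h)
  (low_entropy_words I3 x3 h).
  move=> /(empirical_in_W n0)/Wh; rewrite /min_exp2_entropy !ge_min.
  by case/or3P => /low -> //; rewrite ?orbT.
apply: (@le_trans _ _ (total_cost (x1, x2, x3) (r1, r2, r3))%:E).
  apply: ereal_inf_lbound; exists (r1, r2, r3) => //; split=> //.
  (* A direction of weight 0 has an empty set of low-entropy words, hence no slices, as
     [allowed_size] demands. *)
  by split=> xE; apply/eqP; rewrite -leqn0; [move: le1|move: le2|move: le3];
    rewrite /low_entropy_words xE eqxx cards0.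
rewrite lee_fin /total_cost.
have cost (I : finType) x r : 0 <= x -> #|I|%:R / x <= d ->
    (r <= #|low_entropy_words I x h|)%N ->
    slice_cost x r <= n.+1%:R `^ d * 2 `^ (n%:R * h).
  move=> x0 xd rle; apply: le_trans (slice_cost_low_entropy_le n0 x0 rle) _.
  by rewrite ler_wpM2r ?powR_ge0// ler_powR// ler1n.
have := cost _ _ _ x10 d1 le1; have := cost _ _ _ x20 d2 le2.
have := cost _ _ _ x30 d3 le3; lra.
Qed.

End KroneckerPower.

(** * Passage to the limit *)

Lemma weighted_slice_rank_ge0 (R : realType) (K : fieldType)
    (I1 I2 I3 : finType) (xi : R * R * R) (T : {ffun I1 * I2 * I3 -> K}) :
  (0 <= weighted_slice_rank xi T)%E.
Proof.
apply: le_ereal_inf_tmp => _ [[[r1 r2] r3] _ <-]; rewrite lee_fin.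
by case: xi => [[x1 x2] x3]; rewrite !addr_ge0 ?slice_cost_ge0.
Qed.

Lemma asymptotic_slice_rank_le (R : realType) (K : fieldType)
    (I1 I2 I3 : finType) (T : {ffun I1 * I2 * I3 -> K})
    (xi : R * R * R) (h : R) : Xi xi ->
    (forall p, W T p -> (min_exp2_entropy xi p <= (2 `^ h)%:E)%E) ->
  (asymptotic_slice_rank xi T <= (2 `^ h)%:E)%E.
Proof.
move=> hxi Wh.
have [d [d1 d2 d3]] : exists d : R, [/\ #|I1|%:R / xi.1.1 <= d,
    #|I2|%:R / xi.1.2 <= d & #|I3|%:R / xi.2 <= d].
  exists (Num.max (#|I1|%:R / xi.1.1) (Num.max (#|I2|%:R / xi.1.2)
    (#|I3|%:R / xi.2))); by split; rewrite !le_max lexx ?orbT.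
apply: limn_esup_le => e e0.
(* [b n] is the n-th root of the bound on the n-th power, with the exponential factor already
   reduced to 2 ^ h. *)
pose b n : R := (3 * n.+1%:R `^ d) `^ n%:R^-1 * 2 `^ h.
have bh : b n @[n --> \oo] --> 2 `^ h.
  rewrite -[X in _ --> X]mul1r; apply: cvgM (cvg_cst _).
  exact: cvg_root_polynomial.
have he : 2 `^ h < 2 `^ h + e by rewrite ltrDl.
near=> n; have n0 : (0 < n)%N by near: n; exists 1%N.
apply: (@le_trans _ _ (b n)%:E); last first.
  by rewrite -EFinD lee_fin ltW//; near: n; exact: (cvgr_lt _ bh).
have := weighted_slice_rank_kron_pow_le n0 hxi Wh d1 d2 d3.
move=> /(gt0_ler_poweR (_ : 0 <= n%:R^-1)) /le_trans; apply.
- by rewrite invr_ge0.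
- by rewrite in_itv/= weighted_slice_rank_ge0 leey.
- by rewrite in_itv/= leey lee_fin !mulr_ge0 ?powR_ge0.
- rewrite poweR_EFin lee_fin powRM ?mulr_ge0 ?powR_ge0//.
  by rewrite -powRrM mulrAC mulfV ?mul1r// pnatr_eq0 -lt0n.
Unshelve. all: by end_near. Qed.

Theorem theorem3p20 (R : realType) (K : fieldType) (m1 m2 m3 : nat)
    (T : {ffun 'I_m1 * 'I_m2 * 'I_m3 -> K}) (hT : T <> 0)
    (xi : R * R * R) (hxi : Xi xi) :
  exists M : \bar R,
    is_maximum [set min_exp2_entropy xi p | p in W T] M /\
    (asymptotic_slice_rank xi T <= M)%E.
Proof.
have [h hmax] := max_min_exp2_entropy hT hxi.
exists (2 `^ h)%:E; split=> //; apply: asymptotic_slice_rank_le => // p Wp.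
by apply: hmax.2; exists p.
Qed.
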